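(* Let $\mathscr E$ be the class of all edgeless graphs. An infinite class of graphs $\mathscr C$ is a transduction of $\mathscr E$ (or, equivalently, $\mathscr C\equiv_{\rm FO}\mathscr E$) if and only if $\mathscr C$ is a perturbation of a class whose members have connected components of bounded size (i.e. there is $n$ such that all connected components of all graphs in the class have at most $n$ vertices). Furthermore, $\mathscr C$ is a non-copying transduction of $\mathscr E$ if and only if $\mathscr C$ is a perturbation of $\mathscr E$.
   Context: Graphs are finite, undirected and loopless; a class of graphs is a set of graphs considered up to isomorphism, and every class contains the empty graph. For a set $\mathcal U$ of unary relation symbols, a $\mathcal U$-colored graph is a graph with additional unary relations in $\mathcal U$. Formulas are first-order, with adjacency relation $E$. Transductions. For a positive integer $k$, the $k$-copy operation $\mathsf C_k$ maps a graph $G$ to the graph consisting of $k$ copies of $G$ in which the $k$ copies of each vertex are made pairwise adjacent (no other edges between the copies); $\mathsf C_1$ is the identity. The coloring operation $\Gamma_{\mathcal U}$ maps a graph to the set of all its $\mathcal U$-expansions. A simple interpretation $\mathsf I=(\nu(x),\eta(x,y))$ of graphs in $\mathcal U$-colored graphs is a pair of first-order formulas with $\eta$ symmetric and anti-reflexive; $\mathsf I(G^+)$ is the graph with vertex set $\nu(G^+)$ and edge set $\eta(G^+)\cap\nu(G^+)^2$. A transduction is a composition $\mathsf T=\mathsf I\circ\Gamma_{\mathcal U}\circ\mathsf C_k$, so $\mathsf T(G)=\{\mathsf I(G^+): G^+\in\Gamma_{\mathcal U}(\mathsf C_k(G))\}$; it is non-copying if it can be written with $k=1$. For a class $\mathscr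 D$, $\mathsf T(\mathscr D)=\bigcup_{G\in\mathscr D}\mathsf T(G)$ up to isomorphism. A class $\mathscr C$ is a (non-copying) transduction of $\mathscr D$ if $\mathscr C\subseteq\mathsf T(\mathscr D)$ for some (non-copying) transduction $\mathsf T$; ''is a transduction of'' is written $\mathscr C\sqsubseteq_{\rm FO}\mathscr D$, and $\mathscr C\equiv_{\rm FO}\mathscr D$ means $\mathscr C\sqsubseteq_{\rm FO}\mathscr D$ and $\mathscr D\sqsubseteq_{\rm FO}\mathscr C$. Perturbations. A subset complementation is the transduction that chooses a subset $M$ of vertices (a unary relation) and complements the adjacency inside $M$. A perturbation is a composition of a bounded number of subset complementations. A class $\mathscr C$ is a perturbation of $\mathscr D$ if $\mathscr C\subseteq\mathsf P(\mathscr D)$ for some perturbation $\mathsf P$. *)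

(* Defs.v *)
From HB Require Import structures.
From mathcomp Require Import all_boot.

Set Implicit Arguments.
Unset Strict Implicit.
Unset Printing Implicit Defensive.

(** * Graphs and classes of graphs *)

Record graph := Graph {
  vertex :> finType;
  adj : rel vertex;
  adj_sym : symmetric adj;
  adj_irrefl : irreflexive adj }.

Arguments adj {g} : rename.

Definition iso (G H : graph) : Prop :=
  exists2 f : G -> H, bijective f & forall x y, adj (f x) (f y) = adj x y.

Lemma iso_refl G : iso G G.
Proof. by exists id => //; exists id. Qed.

Definition empty_graph : graph :=
  @Graph void (fun _ _ => false) (fun _ _ => erefl) (fun _ => erefl).

Record graph_class := GraphClass {
  in_class :> graph -> Prop;
  class_iso : forall G H, iso G H -> in_class G -> in_class H;
  class_empty : in_class empty_graph }.

(* Infinite up to isomorphism: no finite family of graphs represents all the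
   isomorphism types of members of the class. *)
Definition infinite_class (C : graph_class) : Prop :=
  forall (n : nat) (F : 'I_n -> graph),
    exists2 G : graph, C G & forall i, ~ iso G (F i).

Definition edgeless (G : graph) : Prop := forall x y : G, ~~ adj x y.

Lemma edgeless_iso G H : iso G H -> edgeless G -> edgeless H.
Proof.
case=> f [g _ gK] fE GE x y.
by rewrite -(gK x) -(gK y) fE; apply: GE.
Qed.

Lemma edgeless_empty : edgeless empty_graph.
Proof. by case. Qed.

Definition edgeless_class : graph_class :=
  GraphClass edgeless_iso edgeless_empty.

Definition bounded_components (D : graph_class) : Prop :=
  exists n : nat,
    forall G : graph, D G -> forall x : G, #|connect (@adj G) x| <= n.

(** * First-order logic on colored graphs *)

(* [formula U n] has its free variables among [n] de Bruijn variables; a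
   quantifier binds variable 0 of its body and shifts the other ones. *)
Inductive formula (U : Type) : nat -> Type :=
| FEq n of 'I_n & 'I_n : formula U n
| FAdj n of 'I_n & 'I_n : formula U n
| FColor n of U & 'I_n : formula U n
| FNot n of formula U n : formula U n
| FAnd n of formula U n & formula U n : formula U n
| FOr n of formula U n & formula U n : formula U n
| FEx n of formula U n.+1 : formula U n
| FAll n of formula U n.+1 : formula U n.

Arguments FEq {U n}.
Arguments FAdj {U n}.
Arguments FColor {U n}.
Arguments FNot {U n}.
Arguments FAnd {U n}.
Arguments FOr {U n}.
Arguments FEx {U n}.
Arguments FAll {U n}.

Definition coloring (U : Type) (G : graph) := U -> {set G}.

Fixpoint sat (U : Type) (G : graph) (c : coloring U G) (n : nat)
    (f : formula U n) : n.-tuple G -> bool :=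
  match f in formula _ n return n.-tuple G -> bool with
  | FEq _ i j => fun e => tnth e i == tnth e j
  | FAdj _ i j => fun e => adj (tnth e i) (tnth e j)
  | FColor _ u i => fun e => tnth e i \in c u
  | FNot _ f => fun e => ~~ sat c f e
  | FAnd _ f g => fun e => sat c f e && sat c g e
  | FOr _ f g => fun e => sat c f e || sat c g e
  | FEx _ f => fun e => [exists x : G, sat c f (cons_tuple x e)]
  | FAll _ f => fun e => [forall x : G, sat c f (cons_tuple x e)]
  end.

(** * Transductions *)

Record interpretation (U : Type) := Interpretation {
  nu : formula U 1;
  eta : formula U 2;
  eta_sym : forall (G : graph) (c : coloring U G) (x y : G),
    sat c eta [tuple x; y] = sat c eta [tuple y; x];
  eta_irrefl : forall (G : graph) (c : coloring U G) (x : G),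
    ~~ sat c eta [tuple x; x] }.

Section Interpret.
Variables (U : Type) (I : interpretation U) (G : graph) (c : coloring U G).

Definition interpret_vertex : finType := {x : G | sat c (nu I) [tuple x]}.

Definition interpret_adj : rel interpret_vertex :=
  fun x y => sat c (eta I) [tuple val x; val y].

Lemma interpret_adj_sym : symmetric interpret_adj.
Proof. by move=> x y; apply: eta_sym. Qed.

Lemma interpret_adj_irrefl : irreflexive interpret_adj.
Proof. by move=> x; apply/negbTE/eta_irrefl. Qed.

Definition interpret : graph := Graph interpret_adj_sym interpret_adj_irrefl.

End Interpret.

Section Copy.
Variables (k : nat) (G : graph).

Definition copy_adj : rel (G * 'I_k) := fun x y =>
  (x.2 == y.2) && adj x.1 y.1 || (x.1 == y.1) && (x.2 != y.2).

Lemma copy_adj_sym : symmetric copy_adj.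
Proof.
by move=> x y; rewrite /copy_adj adj_sym (eq_sym x.1) (eq_sym x.2).
Qed.

Lemma copy_adj_irrefl : irreflexive copy_adj.
Proof. by move=> x; rewrite /copy_adj adj_irrefl !eqxx. Qed.

Definition copy : graph := Graph copy_adj_sym copy_adj_irrefl.

End Copy.

Record transduction := Transduction {
  copies : nat;
  copies_gt0 : 0 < copies;
  colors : Type;
  interp : interpretation colors }.

(* [transduces T G H]: up to isomorphism, [H] is one of the graphs in T(G). *)
Definition transduces (T : transduction) (G H : graph) : Prop :=
  exists c : coloring (colors T) (copy (copies T) G),
    iso (interpret (interp T) c) H.

Definition noncopying (T : transduction) : Prop :=
  exists2 T' : transduction, copies T' = 1
    & forall G H, transduces T G H <-> transduces T' G H.

Definition included_in_image (R : graph -> graph -> Prop)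
    (C D : graph_class) : Prop :=
  forall H, C H -> exists2 G, D G & R G H.

Definition transduction_of (C D : graph_class) : Prop :=
  exists T : transduction, included_in_image (transduces T) C D.

Definition noncopying_transduction_of (C D : graph_class) : Prop :=
  exists2 T : transduction, noncopying T
    & included_in_image (transduces T) C D.

Definition transduction_equiv (C D : graph_class) : Prop :=
  transduction_of C D /\ transduction_of D C.

(** * Perturbations *)

Section Complement.
Variables (G : graph) (M : {set G}).

Definition complement_adj : rel G := fun x y =>
  if [&& x \in M, y \in M & x != y] then ~~ adj x y else adj x y.

Lemma complement_adj_sym : symmetric complement_adj.
Proof.
move=> x y; rewrite /complement_adj adj_sym eq_sym.
by case: (x \in M); case: (y \in M).
Qed.

Lemma complement_adj_irrefl : irreflexive complement_adj.
Proof. by move=> x; rewrite /complement_adj adj_irrefl eqxx !andbF. Qed.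

Definition complement : graph :=
  Graph complement_adj_sym complement_adj_irrefl.

End Complement.

Definition subset_complementation (G H : graph) : Prop :=
  exists M : {set G}, iso (complement M) H.

Fixpoint perturbs (m : nat) (G H : graph) : Prop :=
  if m is m'.+1 then
    exists2 G', subset_complementation G G' & perturbs m' G' H
  else iso G H.

Definition perturbation_of (C D : graph_class) : Prop :=
  exists m : nat, included_in_image (perturbs m) C D.

(* Subset complementation is indeed a non-copying transduction. *)
Section ComplementTransduction.

Let x0 : 'I_2 := ord0.
Let x1 : 'I_2 := ord_max.
Let inM : formula unit 2 := FAnd (FColor tt x0) (FColor tt x1).

Definition complement_eta : formula unit 2 :=
  FAnd (FNot (FEq x0 x1))
    (FOr (FAnd inM (FNot (FAdj x0 x1))) (FAnd (FNot inM) (FAdj x0 x1))).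

Lemma complement_etaE (G : graph) (c : coloring unit G) (x y : G) :
  sat c complement_eta [tuple x; y] = complement_adj (c tt) x y.
Proof.
rewrite /= !(tnth_nth x) /= /complement_adj.
by case: eqVneq => [->|_]; rewrite ?adj_irrefl ?andbF //;
  case: (x \in _); case: (y \in _); case: (adj x y).
Qed.

Lemma complement_eta_sym (G : graph) (c : coloring unit G) (x y : G) :
  sat c complement_eta [tuple x; y] = sat c complement_eta [tuple y; x].
Proof. by rewrite !complement_etaE complement_adj_sym. Qed.

Lemma complement_eta_irrefl (G : graph) (c : coloring unit G) (x : G) :
  ~~ sat c complement_eta [tuple x; x].
Proof. by rewrite complement_etaE complement_adj_irrefl. Qed.

Definition complement_transduction : transduction :=
  @Transduction 1 isT unit
    (@Interpretation unit (FEq ord0 ord0) complement_eta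
      complement_eta_sym complement_eta_irrefl).

End ComplementTransduction.

Lemma iso_sym G H : iso G H -> iso H G.
Proof.
case=> f [g fK gK] fE; exists g; first by exists f.
by move=> x y; rewrite -fE !gK.
Qed.

Lemma iso_trans G H K : iso G H -> iso H K -> iso G K.
Proof.
case=> f fbij fE [g gbij gE]; exists (g \o f); first exact: bij_comp.
by move=> x y /=; rewrite gE fE.
Qed.

Lemma subset_complementationE G H :
  subset_complementation G H <-> transduces complement_transduction G H.
Proof.
pose V (c : coloring unit (copy 1 G)) :=
  interpret (interp complement_transduction) c.
have inV (c : coloring unit (copy 1 G)) (x : G) :
    sat c (nu (interp complement_transduction)) [tuple ((x, ord0) : copy 1 G)].
  by rewrite /= eqxx.
have isoV (c : coloring unit (copy 1 G)) :
    iso (complement [set x : G | (x, ord0) \in c tt]) (V c).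
  exists (fun x : G => exist _ (x, ord0) (inV c x) : V c).
    exists (fun v : V c => (val v).1) => [x //|v].
    by apply: val_inj; case: v => -[x i] vP /=; rewrite (ord1 i).
  move=> x y; rewrite [LHS]complement_etaE /= /complement_adj !inE.
  have -> : @adj (copy 1 G) (x, ord0) (y, ord0) = @adj G x y.
    by rewrite [LHS]/(_ && _ || _ && _) /= andbF; case: adj.
  by rewrite xpair_eqE !eqxx /= !andbT.
split=> [[M GH]|[c VH]].
- exists (fun _ => [set v : copy 1 G | v.1 \in M]).
  apply: iso_trans GH; apply: iso_sym.
  set c := (fun _ => _).
  have -> : M = [set x : G | (x, ord0) \in c tt] by apply/setP => x; rewrite !inE.
  exact: isoV.
- by exists [set x : G | (x, ord0) \in c tt]; apply: iso_trans VH.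
Qed.

(* Main.v *)
Require Import Defs.
From mathcomp Require Import all_boot all_fingroup.

Set Implicit Arguments.
Unset Strict Implicit.
Unset Printing Implicit Defensive.

(** In a disjoint union of coloured [k]-cliques, two cliques with the same
    colours are exchanged by an automorphism.  Hence, for a formula [eta] and
    vertices [x], [y] of different cliques, [eta x y] depends only on the
    types of [x] and [y], where the type of a vertex records the colours of its
    clique and its position there.  There are boundedly many types, so an
    interpreted graph differs from one with no edge between different cliques
    by a symmetric relation on types, which is an exclusive or of boundedly
    many subset complementations.  Conversely, the edges inside clusters of
    bounded size are encoded by colouring their ends, and a subset
    complementation costs one more colour. *)

(** * Transductions as embeddings *)

(** Replaces the subtype cut out by [nu] with an injection [g] of [H] into the copy, so that later
    proofs compute with [g] alone. *)
Lemma transducesP (T : transduction) (G H : graph) :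
  transduces T G H <->
  exists (c : coloring (colors T) (copy (copies T) G))
         (g : H -> copy (copies T) G),
    [/\ injective g,
        forall z, sat c (nu (interp T)) [tuple z] = (z \in codom g)
      & forall x y, sat c (eta (interp T)) [tuple g x; g y] = adj x y].
Proof.
split=> [[c VH]|[c [g [g_inj gN gE]]]]; exists c.
  have [f f_bij fE] := iso_sym VH.
  exists (val \o f); split=> [|z|x y]; last exact: fE.
    exact: inj_comp val_inj (bij_inj f_bij).
  apply/idP/codomP => [zN|[x ->]]; last exact: (valP (f x)).
  have [f' _ f'K] := f_bij.
  by exists (f' (exist _ z zN)); rewrite /= f'K.
have gP x : sat c (nu (interp T)) [tuple g x] by rewrite gN codom_f.
apply: iso_sym; exists (fun x => exist _ (g x) (gP x) : interpret _ c) => //.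
apply: inj_card_bij => [x y [/g_inj]|] //.
by rewrite /= card_sig -(card_codom g_inj) subset_leq_card //; apply/subsetP
  => z; rewrite inE gN.
Qed.

(** * Infinite classes contain large graphs *)

Section SmallGraphs.
Variables (n : nat) (r : {ffun 'I_n * 'I_n -> bool}).

(** Symmetrizing and dropping loops turns every finite function into a graph, so a finite type
    indexes all graphs on ['I_n]. *)
Definition ffun_adj : rel 'I_n :=
  fun x y => (x != y) && (r (x, y) || r (y, x)).

Lemma ffun_adj_sym : symmetric ffun_adj.
Proof. by move=> x y; rewrite /ffun_adj eq_sym orbC. Qed.

Lemma ffun_adj_irrefl : irreflexive ffun_adj.
Proof. by move=> x; rewrite /ffun_adj eqxx. Qed.

Definition ffun_graph : graph := Graph ffun_adj_sym ffun_adj_irrefl.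

End SmallGraphs.

Lemma iso_ffun_graph (G : graph) :
  iso G (ffun_graph
    [ffun p : 'I_#|G| * 'I_#|G| => adj (enum_val p.1) (enum_val p.2)]).
Proof.
exists enum_rank; first exact: enum_rank_bij.
move=> x y /=; rewrite /ffun_adj !ffunE /= !enum_rankK.
rewrite (inj_eq enum_rank_inj) (adj_sym y) orbb.
by case: eqVneq => // ->; rewrite adj_irrefl.
Qed.

(** Otherwise the finite type [K], which indexes the graphs with fewer than [n] vertices, would
    represent the whole class. *)
Lemma infinite_class_large (C : graph_class) (n : nat) :
  infinite_class C -> exists2 G : graph, C G & n <= #|G|.
Proof.
pose K : finType := {i : 'I_n & {ffun 'I_i * 'I_i -> bool}}.
case/(_ #|K| (fun i => ffun_graph (tagged (enum_val i : K)))) => G CG GF.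
exists G => //; rewrite leqNgt; apply/negP => ltGn.
pose k : K := existT _ (Ordinal ltGn)
  [ffun p : 'I_#|G| * 'I_#|G| => adj (enum_val p.1) (enum_val p.2)].
by apply: (GF (enum_rank k)); rewrite enum_rankK; apply: iso_ffun_graph.
Qed.

Definition falsum {U : Type} {n : nat} : formula U n.+1 :=
  FNot (FEq ord0 ord0).

Lemma sat_falsum U (G : graph) (c : coloring U G) n (e : n.+1.-tuple G) :
  sat c falsum e = false.
Proof. by rewrite /= eqxx. Qed.

(** Keeps the marked vertices and erases all edges, so any graph with enough vertices yields a given
    edgeless graph. *)
Definition coloured_vertices : transduction.
Proof.
refine (@Transduction 1 isT unit
  (@Interpretation unit (FColor tt ord0) falsum _ _)).
- by move=> *; rewrite !sat_falsum.
- by move=> *; rewrite sat_falsum.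
Defined.

Lemma edgeless_transduction_of (C : graph_class) :
  infinite_class C -> transduction_of edgeless_class C.
Proof.
move=> C_inf; exists coloured_vertices => H H0.
have [G CG HG] := infinite_class_large #|H| C_inf; exists G => //.
apply/transducesP.
pose g (x : H) : copy 1 G := (enum_val (widen_ord HG (enum_rank x)), ord0).
exists (fun _ => [set z in codom g]), g; split=> [x y []|z|x y].
- by move=> /enum_val_inj [/val_inj/enum_rank_inj].
- by rewrite /= inE.
- by rewrite sat_falsum; apply/esym/negbTE/H0.
Qed.

(** * Perturbations as exclusive ors *)

Lemma complement_adjE (G : graph) (M : {set G}) (x y : G) :
  complement_adj M x y = adj x y (+) (x != y) && ((x \in M) && (y \in M)).
Proof.
rewrite /complement_adj.
by case: (x \in M); case: (y \in M); case: (x != y); case: (adj x y).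
Qed.

(** Complementing [M] toggles the pairs of distinct vertices of [M], so only the parity of the
    number of sets containing both ends matters. *)
Lemma perturbs_seq (G H : graph) (Ms : seq {set G}) (f : G -> H) :
    bijective f ->
    (forall x y, adj (f x) (f y) = adj x y (+)
      (x != y) && odd (count (fun M : {set G} => (x \in M) && (y \in M)) Ms)) ->
  perturbs (size Ms) G H.
Proof.
move sMs: (size Ms) => m f_bij fE.
elim: m G Ms sMs f f_bij fE => [|m IH] G [|M Ms] //= => [_|[sMs]] f f_bij fE.
  by exists f => // x y; rewrite fE andbF addbF.
exists (complement M); first by exists M; apply: iso_refl.
apply: (IH (complement M) Ms sMs f) => // x y.
by rewrite fE oddD oddb andb_addr addbA -complement_adjE.
Qed.

Lemma count_enum1 (B : finType) (b : bool) (q : B) :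
  count (fun p => b && (p == q)) (enum B) = b.
Proof.
case: b => /=; last exact: count_pred0.
by rewrite (count_uniq_mem q (enum_uniq B)) mem_enum.
Qed.

Lemma symmetric_rel_xor (A X : finType) (t : X -> A) (S : rel A) :
    symmetric S ->
  exists2 Ms : seq {set X}, size Ms = #|{: A * A}| + #|A|
    & forall x y, odd (count (fun M : {set X} => (x \in M) && (y \in M)) Ms)
                  = S (t x) (t y).
Proof.
move=> S_sym.
(* The ranks choose one order of each unordered pair. *)
pose P (p : A * A) := (enum_rank p.1 < enum_rank p.2) && S p.1 p.2.
pose c a b := count (fun p => P p && ((a \in pred2 p.1 p.2)
  && (b \in pred2 p.1 p.2))) (enum {: A * A}).
have cC a b : c a b = c b a.
  by apply: eq_count => p /=; rewrite [in LHS](andbC (a \in _)).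
have cE a b : a != b -> c a b = S a b.
  wlog ab : a b / enum_rank a < enum_rank b => [IH|] neq_ab.
    case: (ltngtP (enum_rank a) (enum_rank b)) => [/IH|/IH|]; first exact.
      by rewrite cC S_sym eq_sym; apply.
    by move/val_inj/enum_rank_inj/eqP; rewrite (negbTE neq_ab).
  rewrite -[RHS](count_enum1 _ (a, b)); apply: eq_count => -[u v].
  rewrite /P /= !inE xpair_eqE.
  apply/idP/idP => [/andP[/andP[uv Suv]]|]; last first.
    by case/and3P=> Sab /eqP-> /eqP->; rewrite ab Sab !eqxx orbT.
  case/andP=> /orP[]/eqP ? /orP[]/eqP ?; subst; rewrite ?eqxx // in neq_ab *.
    by rewrite Suv.
  by have := ltn_trans ab uv; rewrite ltnn.
(* The sets attached to the pairs {a, b} also contribute to the diagonal: [D]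
   corrects this. *)
pose D a := S a a (+) odd (c a a).
exists ([seq [set x | P p & t x \in pred2 p.1 p.2] | p <- enum {: A * A}] ++
        [seq [set x | D a & t x == a] | a <- enum A]).
  by rewrite size_cat !size_map !cardE !enumT.
move=> x y; rewrite count_cat [X in X + _]count_map [X in _ + X]count_map oddD.
set cpairs := (X in odd X (+) _); set cdiag := (X in _ (+) odd X).
have -> : cpairs = c (t x) (t y).
  by apply: eq_count => p /=; rewrite !inE; case: (P p).
have -> : cdiag = (t x == t y) && D (t x).
  rewrite -[RHS](count_enum1 _ (t x)); apply: eq_count => a /=.
  rewrite !inE (eq_sym a); case: (t x =P a) => [->|_]; last by rewrite !andbF.
  by rewrite eq_sym; case: (D a); rewrite ?andbF ?andbT.
case: eqVneq => [<-|/cE->] /=; last by rewrite addbF oddb.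
by rewrite /D oddb addbC -addbA addbb addbF.
Qed.

(** * From transductions to perturbations *)

(** The parts are fibres of a labelling rather than components: the traces of the cliques need not
    be connected. *)
Definition clustered (n : nat) (G : graph) : Prop :=
  exists (A : finType) (f : G -> A),
    (forall x y, adj x y -> f x = f y) /\ forall a, #|[set x | f x == a]| <= n.

(** [U] may be infinite; a formula sees only these colours, which keeps the number of types
    finite. *)
Fixpoint fcolors (U : Type) (n : nat) (f : formula U n) : seq U :=
  match f with
  | FEq _ _ _ | FAdj _ _ _ => [::]
  | FColor _ u _ => [:: u]
  | FNot _ f | FEx _ f | FAll _ f => fcolors f
  | FAnd _ f g | FOr _ f g => fcolors f ++ fcolors g
  end.

(** Surjectivity of [s] carries the witnesses of quantifiers back. The colour hypothesis ranges over
    sets of vertices because [U] may lack a decidable equality. *)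
Lemma sat_automorphism (U : Type) (G : graph) (c : coloring U G) (s : G -> G)
    (n : nat) (f : formula U n) (e : n.-tuple G) :
    bijective s -> (forall x y, adj (s x) (s y) = adj x y) ->
    {in map c (fcolors f), forall (M : {set G}) x, (s x \in M) = (x \in M)} ->
  sat c f (map_tuple s e) = sat c f e.
Proof.
move=> s_bij s_adj.
have s_inj := bij_inj s_bij; have [s' _ s'K] := s_bij.
have cons_map m x (e' : m.-tuple G) :
  cons_tuple (s x) (map_tuple s e') = map_tuple s (cons_tuple x e').
  exact: val_inj.
elim: f e => /= {n} [n i j|n i j|n u i|n f IH|n f IHf g IHg|n f IHf g IHg
  |n f IH|n f IH] e sM.
- by rewrite !tnth_map (inj_eq s_inj).
- by rewrite !tnth_map s_adj.
- by rewrite tnth_map sM ?inE.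
- by rewrite IH.
- by rewrite IHf ?IHg // => M fM; apply: sM; rewrite map_cat mem_cat fM ?orbT.
- by rewrite IHf ?IHg // => M fM; apply: sM; rewrite map_cat mem_cat fM ?orbT.
- apply/existsP/existsP => -[x fx].
    by exists (s' x); rewrite -IH // -cons_map s'K.
  by exists (s x); rewrite cons_map IH.
- apply/forallP/forallP => fx x.
    by rewrite -IH // -cons_map.
  by rewrite -(s'K x) cons_map IH.
Qed.

Lemma perm_two (V : finType) (B : eqType) (h : V -> B) (v w v' w' : V) :
    v != w -> v' != w' -> h v = h v' -> h w = h w' ->
  exists s : {perm V}, [/\ s v = v', s w = w' & forall x, h (s x) = h x].
Proof.
move=> vw vw' hv hw.
have h_tperm a b x : h a = h b -> h (tperm a b x) = h x.
  by move=> hab; case: tpermP => // ->.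
(* The first factor sends [v] to [v']; the second sends the image of [w] to [w'] and fixes [v'],
   which differs from both. Each exchanges points with equal [h]. *)
exists (tperm v v' * tperm (tperm v v' w) w')%g.
rewrite !permM tpermL tpermL; split=> // [|x]; last first.
  by rewrite permM !h_tperm.
apply: tpermD; last by rewrite eq_sym.
by rewrite (can2_eq (tpermK _ _) (tpermK _ _)) tpermR eq_sym.
Qed.

Section CliqueTypes.
Variables (U : Type) (k : nat) (G : graph) (c : coloring U (copy k G)).
Variables (f : formula U 2).
Hypothesis G_edgeless : edgeless G.

Let ct (v : G) : {ffun 'I_k * 'I_(size (fcolors f)) -> bool} :=
  [ffun p : 'I_k * 'I_(size (fcolors f)) =>
    (v, p.1) \in nth set0 (map c (fcolors f)) p.2].

Definition vertex_type (z : copy k G) := (ct z.1, z.2).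

(** As [G] has no edge, a permutation of its vertices lifts to an automorphism of the copy;
    [perm_two] gives one that moves both cliques as required and respects the colours. *)
Lemma sat_vertex_type (x y x' y' : copy k G) :
    x.1 != y.1 -> x'.1 != y'.1 ->
    vertex_type x = vertex_type x' -> vertex_type y = vertex_type y' ->
  sat c f [tuple x; y] = sat c f [tuple x'; y'].
Proof.
case: x y x' y' => [v i] [w j] [v' i'] [w' j'] /= vw vw' [hv <-] [hw <-].
have [s [sv sw hs]] := perm_two vw vw' hv hw.
pose s' (z : copy k G) : copy k G := (s z.1, z.2).
have -> : [tuple (v', i); (w', j)] = map_tuple s' [tuple (v, i); (w, j)].
  by apply: val_inj; rewrite /= /s' /= sv sw.
apply/esym/sat_automorphism.
- by exists (fun z => ((s^-1)%g z.1, z.2)) => -[a l];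
    rewrite /s' /= ?permK ?permKV.
- move=> [a l] [b m]; rewrite /adj /= /copy_adj /= (inj_eq perm_inj).
  by rewrite !(negbTE (G_edgeless _ _)).
- move=> M /(nthP set0)[u]; rewrite size_map => ltu <- [a l].
  have /ffunP/(_ (l, Ordinal ltu)) := hs a.
  by rewrite !ffunE.
Qed.

End CliqueTypes.

Lemma clustered_perturbation (T : transduction) :
  exists m : nat, forall G H : graph, edgeless G -> transduces T G H ->
    exists2 K : graph, clustered (copies T) K & perturbs m K H.
Proof.
set k := copies T; set f := eta (interp T).
pose A : finType := ({ffun 'I_k * 'I_(size (fcolors f)) -> bool} * 'I_k)%type.
exists (#|{: A * A}| + #|A|) => G H G0 /transducesP[c [g [g_inj _ gE]]].
pose t (x : H) : A := vertex_type c f (g x).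
(* One edge of [H] between different cliques is enough to relate their types: by [sat_vertex_type],
   all such pairs of these types agree. *)
pose S (a b : A) := [exists x : H, exists y : H,
  [&& (g x).1 != (g y).1, t x == a, t y == b & adj x y]].
have S_sym : symmetric S.
  by move=> a b; apply/existsP/existsP => -[x /existsP[y /and4P[xy xa yb xEy]]];
    exists y; apply/existsP; exists x; rewrite eq_sym xy xa yb adj_sym.
have SE x y : (g x).1 != (g y).1 -> S (t x) (t y) = adj x y.
  move=> xy; apply/existsP/idP => [|xEy].
    case=> x' /existsP[y' /and4P[xy' /eqP xx /eqP yy]].
    by rewrite -!gE (sat_vertex_type G0 xy' xy).
  by exists x; apply/existsP; exists y; rewrite xy !eqxx.
(* The test [x != y] excludes loops, as [S] may relate a type to itself. *)
pose K_adj : rel H := fun x y => (x != y) && (adj x y (+) S (t x) (t y)).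
have K_sym : symmetric K_adj.
  by move=> x y; rewrite /K_adj eq_sym adj_sym S_sym.
have K_irrefl : irreflexive K_adj by move=> x; rewrite /K_adj eqxx.
exists (Graph K_sym K_irrefl).
  (* The clusters are the traces of the cliques; the position in the clique bounds their size by
     [k]. *)
  exists G, (fun x => (g x).1); split=> [x y /andP[_]|a].
    by apply: contraTeq => /SE->; rewrite addbb.
  rewrite -[leqRHS]card_ord -(card_in_imset (f := fun x => (g x).2)).
    exact: max_card.
  move=> x y; rewrite !inE => /eqP xa /eqP ya xy; apply: g_inj.
  by rewrite [g x]surjective_pairing [g y]surjective_pairing xa ya xy.
have [Ms <- MsE] := symmetric_rel_xor t S_sym.
apply: (@perturbs_seq (Graph K_sym K_irrefl) H Ms id) => [|x y].
  by exists id.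
rewrite MsE /= /K_adj; case: eqVneq => [->|_] /=; first exact: adj_irrefl.
by rewrite -addbA addbb addbF.
Qed.

(** * From perturbations to transductions *)

Fixpoint fmap (U V : Type) (h : U -> V) (n : nat) (f : formula U n) :
    formula V n :=
  match f with
  | FEq _ i j => FEq i j
  | FAdj _ i j => FAdj i j
  | FColor _ u i => FColor (h u) i
  | FNot _ f => FNot (fmap h f)
  | FAnd _ f g => FAnd (fmap h f) (fmap h g)
  | FOr _ f g => FOr (fmap h f) (fmap h g)
  | FEx _ f => FEx (fmap h f)
  | FAll _ f => FAll (fmap h f)
  end.

Lemma sat_fmap (U V : Type) (h : U -> V) (G : graph) (c : coloring V G)
    (n : nat) (f : formula U n) (e : n.-tuple G) :
  sat c (fmap h f) e = sat (c \o h) f e.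
Proof.
elim: f e => //= {n} [n f IH|n f IHf g IHg|n f IHf g IHg|n f IH|n f IH] e.
- by rewrite IH.
- by rewrite IHf IHg.
- by rewrite IHf IHg.
- by apply: eq_existsb => x; apply: IH.
- by apply: eq_forallb => x; apply: IH.
Qed.

Section ComplementedInterpretation.
Variables (U : Type) (I : interpretation U).

Let inM : formula (option U) 2 :=
  FAnd (FColor None ord0) (FColor None ord_max).
Let eta' : formula (option U) 2 := fmap Some (eta I).

Definition complemented_eta : formula (option U) 2 :=
  FAnd (FNot (FEq ord0 ord_max))
    (FOr (FAnd inM (FNot eta')) (FAnd (FNot inM) eta')).

Lemma complemented_etaE (G : graph) (c : coloring (option U) G) (x y : G) :
  sat c complemented_eta [tuple x; y] =
  (x != y) && (((x \in c None) && (y \in c None))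
               (+) sat (c \o Some) (eta I) [tuple x; y]).
Proof.
rewrite /= !(tnth_nth x) /= sat_fmap; case: (x != y) => //=.
by case: (x \in _); case: (y \in _); case: (sat _ _ _).
Qed.

Lemma complemented_eta_sym (G : graph) (c : coloring (option U) G) (x y : G) :
  sat c complemented_eta [tuple x; y] = sat c complemented_eta [tuple y; x].
Proof. by rewrite !complemented_etaE eq_sym eta_sym (andbC (x \in _)). Qed.

Lemma complemented_eta_irrefl (G : graph) (c : coloring (option U) G) (x : G) :
  ~~ sat c complemented_eta [tuple x; x].
Proof. by rewrite complemented_etaE eqxx. Qed.

Definition complemented : interpretation (option U) :=
  @Interpretation _ (fmap Some (nu I)) complemented_eta
    complemented_eta_sym complemented_eta_irrefl.

End ComplementedInterpretation.

Lemma transduces_iso (T : transduction) (G H K : graph) :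
  iso H K -> transduces T G H -> transduces T G K.
Proof. by move=> HK [c VH]; exists c; apply: iso_trans HK. Qed.

Lemma transduces_complement (T : transduction) (G H K : graph) :
  transduces T G H -> subset_complementation H K ->
  transduces (Transduction (copies_gt0 T) (complemented (interp T))) G K.
Proof.
case/transducesP=> c [g [g_inj gN gE]] [M MK]; apply: transduces_iso MK _.
apply/transducesP.
exists (fun o => if o is Some u then c u else g @: M), g.
split=> // [z|x y]; first by rewrite /= sat_fmap gN.
rewrite complemented_etaE gE /= /complement_adj !(mem_imset _ _ g_inj).
rewrite (inj_eq g_inj); case: eqVneq => [->|_].
  by rewrite adj_irrefl !andbF.
by case: (x \in M); case: (y \in M); case: (adj x y).
Qed.

(** A complementation costs a colour but no copy; keeping the number of copies is what serves the
    non-copying case. *)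
Lemma perturbs_transduces (m : nat) (T : transduction) :
  exists2 T' : transduction, copies T' = copies T
    & forall G H K : graph, transduces T G H -> perturbs m H K ->
      transduces T' G K.
Proof.
elim: m T => [|m IH] T /=.
  by exists T => // G H K GH HK; apply: transduces_iso HK GH.
have [T' T'T T'P] := IH (Transduction (copies_gt0 T) (complemented (interp T))).
exists T' => // G H K GH [H' HH' H'K].
exact: T'P (transduces_complement GH HH') H'K.
Qed.

Definition for_some (U : Type) (A : finType) (n : nat)
    (F : A -> formula U n.+1) : formula U n.+1 :=
  foldr (fun a f => FOr (F a) f) falsum (enum A).

Lemma sat_for_some (U : Type) (A : finType) (n : nat)
    (F : A -> formula U n.+1) (G : graph) (c : coloring U G)
    (e : n.+1.-tuple G) :
  sat c (for_some F) e = [exists a, sat c (F a) e].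
Proof.
rewrite /for_some; transitivity (has (fun a => sat c (F a) e) (enum A)).
  by elim: (enum A) => [|a s IH]; [apply: sat_falsum | rewrite /= IH].
by apply/hasP/existsP => [[a _ Fa]|[a Fa]]; exists a; rewrite ?mem_enum.
Qed.

Section Cluster.
Variable n : nat.

(* The colour [Some (i, j)] marks, in each cluster whose vertices of positions
   [i] and [j] are adjacent, both of these vertices. *)
Definition cluster_eta : formula (option ('I_n * 'I_n)) 2 :=
  FAnd (FAdj ord0 ord_max)
    (for_some (fun p => FAnd (FColor (Some p) ord0) (FColor (Some p) ord_max))).

Lemma cluster_etaE (G : graph) (c : coloring (option ('I_n * 'I_n)) G)
    (x y : G) :
  sat c cluster_eta [tuple x; y] =
  adj x y && [exists p, (x \in c (Some p)) && (y \in c (Some p))].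
Proof.
by rewrite /cluster_eta /= sat_for_some !(tnth_nth x) /=.
Qed.

Lemma cluster_eta_sym (G : graph) (c : coloring (option ('I_n * 'I_n)) G)
    (x y : G) :
  sat c cluster_eta [tuple x; y] = sat c cluster_eta [tuple y; x].
Proof.
by rewrite !cluster_etaE adj_sym; congr (_ && _); apply: eq_existsb => p;
  rewrite andbC.
Qed.

Lemma cluster_eta_irrefl (G : graph) (c : coloring (option ('I_n * 'I_n)) G)
    (x : G) : ~~ sat c cluster_eta [tuple x; x].
Proof. by rewrite cluster_etaE adj_irrefl. Qed.

(** The colour [None] marks the vertices to keep, since a cluster may have fewer than [n]
    members. *)
Definition cluster_interpretation : interpretation (option ('I_n * 'I_n)) :=
  @Interpretation _ (FColor None ord0) cluster_eta
    cluster_eta_sym cluster_eta_irrefl.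

(** Each cluster becomes one vertex of [G], whose copies hold the members of the cluster in their
    order of enumeration. *)
Lemma cluster_transduces (n_gt0 : 0 < n) (H : graph) : clustered n H ->
  exists2 G : graph, edgeless G
    & transduces (Transduction n_gt0 cluster_interpretation) G H.
Proof.
case=> A [f [fE f_le]].
have no_sym : symmetric (fun _ _ : A => false) by [].
have no_irrefl : irreflexive (fun _ _ : A => false) by [].
exists (Graph no_sym no_irrefl) => //; apply/transducesP.
have pos_lt x : index x (enum [set y | f y == f x]) < n.
  by apply: leq_trans (f_le (f x)); rewrite cardE index_mem mem_enum inE.
pose pos x := Ordinal (pos_lt x).
have pos_inj x y : f x = f y -> pos x = pos y -> x = y.
  move=> fxy /(congr1 val) /=; rewrite fxy => /(congr1 (nth x _)) xy.
  have := xy (enum [set z | f z == f y]).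
  by rewrite !nth_index ?mem_enum ?inE ?fxy.
pose g x : copy n (Graph no_sym no_irrefl) := (f x, pos x).
have g_inj : injective g.
  by move=> x y [fxy pxy]; apply: pos_inj => //; apply: val_inj.
have g_adj x y : adj (g x) (g y) = (f x == f y) && (pos x != pos y).
  by rewrite [LHS]/(_ && _ || _ && _) /= andbF.
pose c (o : option ('I_n * 'I_n)) :=
  if o is Some p then
    [set z | [exists x, exists y,
      [&& adj x y, pos x == p.1, pos y == p.2 & (z == g x) || (z == g y)]]]
  else [set z in codom g].
exists c, g; split=> // [z|x y]; first by rewrite /= inE.
rewrite [LHS]cluster_etaE g_adj /=; apply/andP/idP => [[]|xy]; last first.
  split.
    rewrite (fE _ _ xy) eqxx /=.
    apply: contraTneq (xy) => /(pos_inj _ _ (fE _ _ xy)) ->.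
    by rewrite adj_irrefl.
  apply/existsP; exists (pos x, pos y); rewrite !inE /=.
  by apply/andP; split; apply/existsP; exists x; apply/existsP; exists y;
    rewrite xy !eqxx ?orbT.
case/andP=> /eqP fxy pxy /existsP[[i j]]; rewrite !inE => /andP[].
case/existsP=> u /existsP[v /and4P[uv /eqP ui /eqP vj xuv]].
case/existsP=> u' /existsP[v' /and4P[uv' /eqP ui' /eqP vj' yuv]].
move: xuv yuv; rewrite !(inj_eq g_inj) => xuv yuv.
(* The colour [(i, j)] of [x] comes from the edge [u v], that of [y] from [u' v']. These edges lie
   in one cluster with ends at equal positions, so they coincide, and the distinct vertices [x], [y]
   are the two ends. *)
have fuv : f u = f u'.
  have <- : f x = f u by case/orP: xuv => /eqP-> //; rewrite (fE _ _ uv).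
  by rewrite fxy; case/orP: yuv => /eqP-> //; rewrite (fE _ _ uv').
have eu : u = u' by apply: pos_inj; rewrite ?ui.
have ev : v = v'.
  by apply: pos_inj; rewrite ?vj // -(fE _ _ uv) fuv (fE _ _ uv').
subst u' v'; move: pxy.
by case/orP: xuv => /eqP->; case/orP: yuv => /eqP->; rewrite ?eqxx // adj_sym.
Qed.

End Cluster.

(** * Clustered graphs *)

(** Makes the non-copying case the instance [n = 1] of the general argument. *)
Lemma clustered_edgeless (G : graph) : edgeless G <-> clustered 1 G.
Proof.
split=> [G0|[A [f [fE f1]]] x y].
  exists G, id; split=> [x y|a]; first by rewrite (negbTE (G0 x y)).
  by rewrite -(cards1 a) subset_leq_card //; apply/subsetP => x; rewrite !inE.
apply/negP => xy; have /card_le1_eqP/(_ x y) := f1 (f x).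
rewrite !inE eqxx (fE _ _ xy) eqxx => /(_ isT isT) exy.
by move: xy; rewrite exy adj_irrefl.
Qed.

Lemma clustered_iso (n : nat) (G H : graph) :
  iso G H -> clustered n G -> clustered n H.
Proof.
case/iso_sym=> h h_bij hE [A [f [fE f_le]]].
exists A, (f \o h); split=> [x y|a]; first by rewrite -hE => /fE.
rewrite -(card_imset _ (bij_inj h_bij)).
apply: leq_trans (f_le a); apply: subset_leq_card.
by apply/subsetP => _ /imsetP[x + ->]; rewrite !inE.
Qed.

Lemma clustered_empty (n : nat) : clustered n empty_graph.
Proof.
exists void, id; split=> [[]|[]].
Qed.

Definition clustered_class (n : nat) : graph_class :=
  GraphClass (@clustered_iso n) (clustered_empty n).

Lemma clustered_components (n : nat) (G : graph) :
  clustered n G <-> forall x : G, #|connect (@adj G) x| <= n.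
Proof.
have adj_csym := sym_connect_sym (@adj_sym G).
split=> [[A [f [fE f_le]]] x|G_le].
  apply: leq_trans (f_le (f x)); apply: subset_leq_card.
  have f_closed : closed (@adj G) [set y | f y == f x].
    by move=> y z yz; rewrite !inE (fE _ _ yz).
  apply/subsetP => y xy.
  by rewrite -(closed_connect f_closed xy) inE.
exists G, (root (@adj G)); split=> [x y xy|a].
  by apply/(rootP adj_csym)/connect1.
apply: leq_trans (G_le a); apply: subset_leq_card.
apply/subsetP => x; rewrite inE => /eqP <-.
by have := connect_root (@adj G) x; rewrite adj_csym.
Qed.

Lemma clustered_leq (m n : nat) (G : graph) :
  m <= n -> clustered m G -> clustered n G.
Proof.
by move=> mn [A [f [fE f_le]]]; exists A, f; split=> // a; apply: leq_trans mn.
Qed.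

(** * Transductions of the class of edgeless graphs *)

Lemma perturbation_of_clustered (C D : graph_class) (n : nat) :
    0 < n -> (forall G, D G -> clustered n G) -> perturbation_of C D ->
  exists2 T : transduction, copies T = n
    & included_in_image (transduces T) C edgeless_class.
Proof.
move=> n_gt0 Dn [m CD].
have [T Tn TP] :=
  perturbs_transduces m (Transduction n_gt0 (cluster_interpretation n)).
exists T => // H /CD[K /Dn/(cluster_transduces n_gt0)[G G0 GK] KH].
by exists G => //; apply: TP GK KH.
Qed.

Lemma transduction_of_edgeless (C : graph_class) (T : transduction) :
  included_in_image (transduces T) C edgeless_class ->
  perturbation_of C (clustered_class (copies T)).
Proof.
move=> CT; have [m mP] := clustered_perturbation T.
by exists m => H /CT[G G0 GH]; apply: mP GH.
Qed.

Theorem proposition13p1 (C : graph_class) (C_infinite : infinite_class C) :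
  [/\ transduction_of C edgeless_class <->
        transduction_equiv C edgeless_class,
      transduction_of C edgeless_class <->
        exists2 D : graph_class, bounded_components D & perturbation_of C D
    & noncopying_transduction_of C edgeless_class <->
        perturbation_of C edgeless_class].
Proof.
split; split.
- by move=> CE; split=> //; apply: edgeless_transduction_of.
- by case.
- case=> T /transduction_of_edgeless CT.
  exists (clustered_class (copies T)) => //.
  by exists (copies T) => G /clustered_components.
- case=> D [n Dn] CD.
  (* The bound [n] may be zero while a transduction makes at least one copy, hence [n.+1]. *)
  have [|T _ CT] := perturbation_of_clustered (ltn0Sn n) _ CD; last by exists T.
  by move=> G /Dn/clustered_components; apply: clustered_leq.
- case=> T [T' T'1 TT'] CT.
  have /transduction_of_edgeless[m CT'] :
      included_in_image (transduces T') C edgeless_class.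
    by move=> H /CT[G G0 /TT' GH]; exists G.
  exists m => H /CT'[G GT' GH]; exists G => //.
  by apply/clustered_edgeless; rewrite -T'1.
- case/(perturbation_of_clustered (ltn0Sn 0)) => [G /clustered_edgeless //|].
  by move=> T T1 CT; exists T => //; exists T.
Qed.
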